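(* Let $V$ and $V'$ be totally ordered finite sets, let $\mathcal{H}$ be a hypergraph on $V$ and $\mathcal{H}'$ a hypergraph on $V'$, and let $R$ be a commutative ring with unit. A morphism of hypergraphs $\varphi:\mathcal{H}\to\mathcal{H}'$ induces homomorphisms between the homology groups $$(\delta\varphi)_*: H_*(\delta\mathcal{H};R)\to H_*(\delta\mathcal{H}';R),\qquad (\Delta\varphi)_*: H_*(\Delta\mathcal{H};R)\to H_*(\Delta\mathcal{H}';R),\qquad \varphi_*: H_*(\mathcal{H};R)\to H_*(\mathcal{H}';R)$$ such that the following diagram commutes, that is, $$\varphi_*\circ(\iota^\delta)_*=(\iota'^\delta)_*\circ(\delta\varphi)_*,\qquad (\Delta\varphi)_*\circ(\iota^\Delta)_*=(\iota'^\Delta)_*\circ\varphi_*,$$ where $H_*(\delta\mathcal{H};R)\xrightarrow{(\iota^\delta)_*}H_*(\mathcal{H};R)\xrightarrow{(\iota^\Delta)_*}H_*(\Delta\mathcal{H};R)$ and $H_*(\delta\mathcal{H}';R)\xrightarrow{(\iota'^\delta)_*}H_*(\mathcal{H}';R)\xrightarrow{(\iota'^\Delta)_*}H_*(\Delta\mathcal{H}';R)$ are the homomorphisms induced by the canonical inclusions $\delta\mathcal{H}\subseteq\mathcal{H}\subseteq\Delta\mathcal{H}$ and $\delta\mathcal{H}'\subseteq\mathcal{H}'\subseteq\Delta\mathcal{H}'$. In addition, if both $\mathcal{H}$ and $\mathcal{H}'$ are simplicial complexes, then $\varphi$ is a simplicial map and the three homomorphisms $(\delta\varphi)_*$, $(\Delta\varphi)_*$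 and $\varphi_*$ are the same.
   Context: A hypergraph $\mathcal{H}$ on a finite totally ordered set $V$ is a set of non-empty subsets of $V$ (hyperedges); a hyperedge with $n+1$ elements has dimension $n$ (an $n$-hyperedge). A simplicial complex is a hypergraph closed under taking non-empty subsets of hyperedges; its hyperedges are called simplices. The associated simplicial complex $\Delta\mathcal{H}$ is the smallest simplicial complex containing $\mathcal{H}$; the lower-associated simplicial complex $\delta\mathcal{H}$ is the largest simplicial complex contained in $\mathcal{H}$. A morphism of hypergraphs $\varphi:\mathcal{H}\to\mathcal{H}'$ is a map $\varphi:V\to V'$ such that for each $\sigma=\{v_0,\dots,v_k\}\in\mathcal{H}$ the set $\varphi(\sigma)=\{\varphi(v_0),\dots,\varphi(v_k)\}$ is a hyperedge of $\mathcal{H}'$. It induces simplicial maps $\delta\varphi:\delta\mathcal{H}\to\delta\mathcal{H}'$ and $\Delta\varphi:\Delta\mathcal{H}\to\Delta\mathcal{H}'$ given by $\sigma\mapsto\varphi(\sigma)$; $(\delta\varphi)_*$ and $(\Delta\varphi)_*$ are the usual induced maps on simplicial homology. For a simplicial complex $\mathcal{K}$, $C_*(\mathcal{K};R)$ is the (ordered by the vertex order) simplicial chain complex, $C_n$ free on the $n$-simplices, with $\partial_n\{v_0\prec\dots\prec v_n\}=\sum_i(-1)^i\{v_0,\dots,\widehat{v_i},\dots,v_n\}$, and $C_{-1}=0$. Let $R(\mathcal{H})_n\subseteq C_n(\Delta\mathcal{H};R)$ be the free $R$-module generated by the $n$-hyperedges of $\mathcal{H}$. Put $\mathrm{Inf}_n(\mathcal{H})=R(\mathcal{H})_n\cap\partial_n^{-1}(R(\mathcal{H})_{n-1})$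 and $\mathrm{Sup}_n(\mathcal{H})=R(\mathcal{H})_n+\partial_{n+1}(R(\mathcal{H})_{n+1})$; these are sub-chain complexes of $C_*(\Delta\mathcal{H};R)$, and the inclusion $\mathrm{Inf}_*(\mathcal{H})\hookrightarrow\mathrm{Sup}_*(\mathcal{H})$ induces an isomorphism on homology. The embedded homology $H_*(\mathcal{H};R)$ is the homology of $\mathrm{Inf}_*(\mathcal{H})$ (identified with that of $\mathrm{Sup}_*(\mathcal{H})$ via this isomorphism); for a simplicial complex it is the usual homology. The map $(\iota^\delta)_*$ is induced by the inclusion of chain complexes $C_*(\delta\mathcal{H};R)\subseteq\mathrm{Inf}_*(\mathcal{H})$ and $(\iota^\Delta)_*$ by the inclusion $\mathrm{Sup}_*(\mathcal{H})\subseteq C_*(\Delta\mathcal{H};R)$; similarly for $\mathcal{H}'$. The map $\varphi_*$ is induced by the restriction to $\mathrm{Inf}_*(\mathcal{H})\to\mathrm{Inf}_*(\mathcal{H}')$ of the simplicial chain map $C_*(\Delta\mathcal{H};R)\to C_*(\Delta\mathcal{H}';R)$ induced by $\Delta\varphi$ (a simplex $\sigma$ goes to $\pm\varphi(\sigma)$ with the usual permutation sign if $\varphi$ is injective on $\sigma$, and to $0$ otherwise). *)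

(* Defs.v *)
From HB Require Import structures.
From mathcomp Require Import all_boot all_order all_algebra.
From mathcomp Require Import boolp.

Set Implicit Arguments.
Unset Strict Implicit.
Unset Printing Implicit Defensive.

Import Order.TTheory GRing.Theory.
Export Quotient.Exports.
Local Open Scope ring_scope.

Section Hypergraphs.
Variables (d : Order.disp_t) (V : finOrderType d).

Record hypergraph := Hypergraph {
  hedges :> {set {set V}};
  hedges_neq0 : set0 \notin hedges }.

Definition is_complex (K : {set {set V}}) : bool :=
  (set0 \notin K) &&
  [forall s in K, forall t : {set V}, (t \subset s) && (t != set0) ==> (t \in K)].

Lemma is_complexP (K : {set {set V}}) :
  reflect (set0 \notin K /\
           forall s t : {set V}, s \in K -> t \subset s -> t != set0 -> t \in K)
          (is_complex K).
Proof.
apply: (iffP andP) => -[K0 cK]; split=> //.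
  by move=> s t sK ts t0; have /forall_inP/(_ s sK)/forallP/(_ t) := cK;
     rewrite ts t0.
apply/forall_inP => s sK; apply/forallP => t; apply/implyP => /andP[ts t0].
exact: cK sK ts t0.
Qed.

(* The smallest complex containing [H] and the largest complex contained in
   [H], as an intersection and a union of complexes. *)
Definition Delta_set (H : {set {set V}}) : {set {set V}} :=
  \bigcap_(K : {set {set V}} | is_complex K && (H \subset K)) K.

Definition delta_set (H : {set {set V}}) : {set {set V}} :=
  \bigcup_(K : {set {set V}} | is_complex K && (K \subset H)) K.

Lemma Delta_set_sub (H : {set {set V}}) : H \subset Delta_set H.
Proof. by apply/bigcapsP => K /andP[]. Qed.

Lemma Delta_set_min (H K : {set {set V}}) :
  is_complex K -> H \subset K -> Delta_set H \subset K.
Proof. by move=> cK HK; apply: bigcap_inf; rewrite cK. Qed.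

Lemma Delta_set_complex (H : hypergraph) : is_complex (Delta_set H).
Proof.
have c1 : is_complex [set t : {set V} | t != set0].
  by apply/is_complexP; split=> [|s t _ _]; rewrite !inE ?eqxx.
have H1 : H \subset [set t : {set V} | t != set0].
  by apply/subsetP => s sH; rewrite inE; apply: contraNneq (hedges_neq0 H) => <-.
apply/is_complexP; split.
  apply/negP => /(subsetP (Delta_set_min c1 H1)).
  by rewrite inE eqxx.
move=> s t /bigcapP sD ts t0; apply/bigcapP => K /[dup] pK /andP[/is_complexP[_ cK] _].
exact: cK (sD K pK) ts t0.
Qed.

Lemma delta_set_sub (H : {set {set V}}) : delta_set H \subset H.
Proof. by apply/bigcupsP => K /andP[]. Qed.

Lemma delta_set_max (H K : {set {set V}}) :
  is_complex K -> K \subset H -> K \subset delta_set H.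
Proof. by move=> cK HK; apply: bigcup_sup; rewrite cK. Qed.

Lemma delta_set_complex (H : {set {set V}}) : is_complex (delta_set H).
Proof.
apply/is_complexP; split.
  by apply/negP => /bigcupP[K /andP[/is_complexP[K0 _] _]]; apply/negP.
move=> s t /bigcupP[K pK sK] ts t0; apply/bigcupP; exists K => //.
by case/andP: pK => /is_complexP[_ cK] _; apply: cK sK ts t0.
Qed.

Definition Delta (H : hypergraph) : hypergraph :=
  Hypergraph (is_complexP _ (Delta_set_complex H)).1.

Definition delta (H : hypergraph) : hypergraph :=
  Hypergraph (is_complexP _ (delta_set_complex H)).1.

End Hypergraphs.

Definition hypergraph_morphism (d d' : Order.disp_t) (V : finOrderType d)
    (V' : finOrderType d') (H : hypergraph V) (H' : hypergraph V')
    (phi : V -> V') : Prop :=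
  forall s : {set V}, s \in H -> phi @: s \in H'.

Definition simplicial_map (d d' : Order.disp_t) (V : finOrderType d)
    (V' : finOrderType d') (K : hypergraph V) (K' : hypergraph V')
    (phi : V -> V') : Prop :=
  [/\ is_complex K, is_complex K'
    & forall s : {set V}, s \in K -> phi @: s \in K'].

Lemma morphism_Delta (d d' : Order.disp_t) (V : finOrderType d)
    (V' : finOrderType d') (H : hypergraph V) (H' : hypergraph V')
    (phi : V -> V') :
  hypergraph_morphism H H' phi -> simplicial_map (Delta H) (Delta H') phi.
Proof.
move=> phiP; split; [exact: Delta_set_complex|exact: Delta_set_complex|] => s sD.
have /is_complexP[D0 cD] := Delta_set_complex H'.
pose K := [set t : {set V} | (t != set0) && (phi @: t \in Delta_set H')].
suff /subsetP/(_ s sD) : Delta_set H \subset K by rewrite inE => /andP[].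
apply: Delta_set_min.
  apply/is_complexP; split=> [|t u]; rewrite !inE ?eqxx // => /andP[_ tD] ut u0.
  by rewrite u0 (cD _ _ tD) ?imsetS ?imset_eq0.
apply/subsetP => t tH; rewrite inE (subsetP (Delta_set_sub H')) ?phiP // andbT.
by apply: contraNneq (hedges_neq0 H) => <-.
Qed.

Lemma morphism_delta (d d' : Order.disp_t) (V : finOrderType d)
    (V' : finOrderType d') (H : hypergraph V) (H' : hypergraph V')
    (phi : V -> V') :
  hypergraph_morphism H H' phi -> simplicial_map (delta H) (delta H') phi.
Proof.
move=> phiP; split; [exact: delta_set_complex|exact: delta_set_complex|] => s sd.
have /is_complexP[d0 cd] := delta_set_complex H.
pose K := [set phi @: (t : {set V}) | t in delta_set H].
suff /subsetP : K \subset delta_set H' by apply; apply: imset_f.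
apply: delta_set_max.
  apply/is_complexP; split=> [|_ u /imsetP[t td ->] ut u0].
    apply/imsetP => -[t td /esym/eqP]; rewrite imset_eq0 => /eqP t0.
    by move: td; rewrite t0 (negPf d0).
  have uE : u = phi @: (t :&: phi @^-1: u).
    apply/setP => y; apply/idP/imsetP => [yu|[x]]; last by rewrite !inE => /andP[_ +] ->.
    by have /imsetP[x xt yx] := subsetP ut y yu; exists x; rewrite // !inE xt -yx.
  rewrite uE; apply: imset_f; apply: cd td (subsetIl _ _) _.
  by apply: contraNneq u0 => e; rewrite uE e imset0.
by apply/subsetP => _ /imsetP[t td ->]; apply/phiP/(subsetP (delta_set_sub H)).
Qed.

(* All chain complexes are realized inside one free module, with one basis
   element [simplex s] for each [s : {set V}]; the chains on a given set of
   simplices, in a given dimension, are those supported on it. The boundary of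
   a vertex is [0] (and not a multiple of [simplex set0]), as [C_{-1} = 0]. *)

Section Chains.
Variables (R : comPzRingType) (d : Order.disp_t) (V : finOrderType d).

Definition chain := {ffun {set V} -> R^o}.

HB.instance Definition _ := GRing.Lmodule.on chain.

Definition simplex (s : {set V}) : chain := [ffun t => (t == s)%:R].

(* If s = {v_0 < ... < v_n}, then [vindex s v_i = i]. *)
Definition vindex (s : {set V}) (v : V) : nat := #|[set u in s | (u < v)%O]|.

Definition simplex_boundary (s : {set V}) : chain :=
  if (1 < #|s|)%N
  then \sum_(v in s) (-1) ^+ vindex s v *: simplex (s :\ v)
  else 0.

Definition boundary (c : chain) : chain := \sum_s c s *: simplex_boundary s.

Lemma chain_sum (c : chain) : c = \sum_s c s *: simplex s.
Proof.
apply/ffunP => t; rewrite sum_ffunE (bigD1 t) //= big1 => [|s st].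
  by rewrite !ffunE eqxx addr0 [RHS]mulr1.
by rewrite !ffunE eq_sym (negPf st) [LHS]mulr0.
Qed.

Lemma boundary_is_linear : linear boundary.
Proof.
move=> a x y; rewrite /boundary scaler_sumr -big_split /=.
by apply: eq_bigr => s _; rewrite !ffunE scalerDl scalerA.
Qed.

HB.instance Definition _ :=
  GRing.isLinear.Build R chain chain _ boundary boundary_is_linear.

Lemma boundary_simplex (s : {set V}) : boundary (simplex s) = simplex_boundary s.
Proof.
rewrite /boundary (bigD1 s) //= big1 => [|t ts]; last by rewrite ffunE (negPf ts) scale0r.
by rewrite ffunE eqxx scale1r addr0.
Qed.

Lemma vindexD1 (s : {set V}) (v w : V) : v \in s ->
  vindex s w = ((v < w)%O + vindex (s :\ v) w)%N.
Proof.
move=> vs; rewrite /vindex (cardsD1 v) inE vs /=; congr (_ + _)%N.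
by apply: eq_card => u; rewrite !inE andbA.
Qed.

Lemma boundaryK (c : chain) : boundary (boundary c) = 0.
Proof.
rewrite [boundary c]/boundary linear_sum big1 //= => s _.
rewrite linearZ /= [X in _ *: X](_ : _ = 0) ?scaler0 //.
rewrite /simplex_boundary; case: ifP => s2; last by rewrite linear0.
rewrite linear_sum /=.
have [s3|s3] := ltnP 2 #|s|; last first.
  rewrite big1 // => v vs; rewrite linearZ /= boundary_simplex /simplex_boundary.
  by rewrite ifN ?scaler0 // -leqNgt; move: s3; rewrite (cardsD1 v s) vs.
pose F v w := (-1) ^+ (vindex s v + vindex (s :\ v) w) *: simplex (s :\ v :\ w).
rewrite (eq_bigr (fun v => \sum_(w in s | w != v) F v w)); last first.
  move=> v vs; rewrite linearZ /= boundary_simplex /simplex_boundary.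
  rewrite ifT; last by move: s3; rewrite (cardsD1 v s) vs.
  rewrite scaler_sumr; apply: eq_big => [w|w _]; first by rewrite !inE andbC.
  by rewrite scalerA -exprD.
have Fneg v w : v \in s -> w \in s -> (v < w)%O -> F v w + F w v = 0.
  move=> vs ws vw; rewrite /F.
  have -> : s :\ w :\ v = s :\ v :\ w by apply/setP => u; rewrite !inE andbCA.
  rewrite (vindexD1 w vs) vw (vindexD1 v ws) (ltNge w) (ltW vw) /= add0n add1n.
  by rewrite addSn addnC exprS mulN1r scaleNr subrr.
rewrite (eq_bigr (fun v => \sum_(w in s | (v < w)%O) F v w
                         + \sum_(w in s | (w < v)%O) F v w)); last first.
  move=> v vs; rewrite (bigID (fun w => (v < w)%O)) /=.
  congr (_ + _); apply: eq_bigl => w; rewrite -andbA; congr (_ && _);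
    by case: ltgtP; rewrite ?andbF.
rewrite big_split /= [X in _ + X](exchange_big_dep (mem s)) //=; last by move=> v w _ /andP[].
rewrite -big_split big1 //= => v vs.
rewrite [X in _ + X](eq_bigl (fun w => (w \in s) && (v < w)%O)); last first.
  by move=> w; rewrite vs.
by rewrite -big_split big1 //= => w /andP[ws vw]; apply: Fneg.
Qed.

(* [Rspan E n] is the free module on the n-dimensional elements of [E]. *)
Definition Rspan (E : {set {set V}}) (n : nat) : {pred chain} :=
  [pred c : chain | [forall s, (c s != 0) ==> (s \in E) && (#|s| == n.+1)]].

Lemma RspanP (E : {set {set V}}) (n : nat) (c : chain) :
  reflect (forall s, c s != 0 -> s \in E /\ #|s| = n.+1) (c \in Rspan E n).
Proof.
apply: (iffP forallP) => h s; first by move=> cs; have := h s; rewrite cs => /andP[-> /eqP].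
by apply/implyP => /h[-> ->]; rewrite eqxx.
Qed.

Lemma Rspan_closed E n : submod_closed (Rspan E n).
Proof.
split=> [|a x y /RspanP hx /RspanP hy]; first by apply/RspanP => s; rewrite ffunE eqxx.
apply/RspanP => s; rewrite !ffunE; have [x0|/hx//] := eqVneq (x s) 0.
by rewrite x0 scaler0 add0r; apply: hy.
Qed.

HB.instance Definition _ E n :=
  GRing.isSubmodClosed.Build R chain (Rspan E n) (Rspan_closed E n).

Lemma Rspan_simplex (E : {set {set V}}) (n : nat) (s : {set V}) :
  s \in E -> #|s| = n.+1 -> simplex s \in Rspan E n.
Proof.
move=> sE sn; apply/RspanP => t; rewrite ffunE.
by have [->|_] := eqVneq t s; rewrite ?eqxx.
Qed.

Lemma Rspan_sub (E F : {set {set V}}) (n : nat) (c : chain) :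
  E \subset F -> c \in Rspan E n -> c \in Rspan F n.
Proof.
by move=> EF /RspanP hc; apply/RspanP => s /hc[/(subsetP EF)].
Qed.

Lemma boundary_Rspan0 E (c : chain) : c \in Rspan E 0 -> boundary c = 0.
Proof.
move=> /RspanP hc; rewrite /boundary big1 // => s _.
have [->|/hc[_ s1]] := eqVneq (c s) 0; first by rewrite scale0r.
by rewrite /simplex_boundary s1 /= scaler0.
Qed.

Lemma boundary_complex (K : {set {set V}}) (n : nat) (c : chain) :
  is_complex K -> c \in Rspan K n.+1 -> boundary c \in Rspan K n.
Proof.
move=> /is_complexP[_ cK] /RspanP hc; apply: rpred_sum => s _.
have [->|/hc[sK sn]] := eqVneq (c s) 0; first by rewrite scale0r rpred0.
rewrite rpredZ // /simplex_boundary sn /=; apply: rpred_sum => v vs; rewrite rpredZ //.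
have sv : #|s :\ v| = n.+1 by move: sn; rewrite (cardsD1 v s) vs => -[].
apply: Rspan_simplex => //; apply: cK sK (subsetDl _ _) _.
by rewrite -card_gt0 sv.
Qed.

Record subcomplex := Subcomplex {
  sc_mod :> nat -> {pred chain};
  sc_closed : forall n, submod_closed (sc_mod n);
  sc_dim : forall n c, c \in sc_mod n -> c \in Rspan setT n;
  sc_boundary : forall n c, c \in sc_mod n.+1 -> boundary c \in sc_mod n }.

HB.instance Definition _ (D : subcomplex) n :=
  GRing.isSubmodClosed.Build R chain (sc_mod D n) (sc_closed D n).

Definition cycles (D : subcomplex) (n : nat) : {pred chain} :=
  [pred c : chain | (c \in D n) && (boundary c == 0)].

Lemma cycles_closed D n : submod_closed (cycles D n).
Proof.
split=> [|a x y /andP[xD /eqP bx] /andP[yD /eqP yb]]; rewrite inE.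
  by rewrite rpred0 linear0 eqxx.
by rewrite rpredD ?rpredZ // linearP /= bx yb scaler0 addr0 eqxx.
Qed.

HB.instance Definition _ D n :=
  GRing.isSubmodClosed.Build R chain (cycles D n) (cycles_closed D n).

Record cycle (D : subcomplex) (n : nat) := Cycle {
  cycle_val : chain;
  cycleP : cycle_val \in cycles D n }.

HB.instance Definition _ D n := [isSub for @cycle_val D n].
HB.instance Definition _ D n := [Choice of cycle D n by <:].
HB.instance Definition _ D n :=
  [SubChoice_isSubLmodule of cycle D n by <:].

Definition boundaries (D : subcomplex) (n : nat) : {pred cycle D n} :=
  [pred z : cycle D n | `[< exists2 b, b \in D n.+1 & cycle_val z = boundary b >]].

Arguments boundaries D n _ : clear implicits.

Lemma boundaries_closed D n : submod_closed (boundaries D n).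
Proof.
split=> [|a x y /asboolP[b bD xb] /asboolP[b' bD' yb']]; apply/asboolP.
  by exists 0; rewrite ?rpred0 ?linear0.
exists (a *: b + b'); first by rewrite rpredD ?rpredZ.
by rewrite linearP /= -xb -yb'.
Qed.

HB.instance Definition _ D n :=
  GRing.isSubmodClosed.Build R (cycle D n) (boundaries D n) (boundaries_closed D n).

Definition homology (D : subcomplex) (n : nat) : Type := Quotient.quot (boundaries D n).

HB.instance Definition _ D n := GRing.Zmodule.on (homology D n).

Definition hclass (D : subcomplex) (n : nat) (z : cycle D n) : homology D n :=
  (\pi_(Quotient.quot (boundaries D n)) z)%qT.

Definition hrepr (D : subcomplex) (n : nat) (x : homology D n) : cycle D n :=
  repr (x : Quotient.quot (boundaries D n)).

Lemma hreprK D n : cancel (@hrepr D n) (@hclass D n).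
Proof. by move=> x; rewrite /hclass reprK. Qed.

Lemma hclass_eq D n (z z' : cycle D n) :
  reflect (hclass z = hclass z') (z - z' \in boundaries D n).
Proof. by rewrite Quotient.idealrBE; apply: eqP. Qed.

Lemma hclassB D n : zmod_morphism (@hclass D n).
Proof. by move=> x y; rewrite /hclass raddfB. Qed.

HB.instance Definition _ D n :=
  GRing.isZmodMorphism.Build (cycle D n) (homology D n) (@hclass D n) (@hclassB D n).

Definition hscale D n (a : R) (x : homology D n) : homology D n :=
  hclass (a *: hrepr x).

Lemma hclassZ_subproof D n a (z : cycle D n) : hscale a (hclass z) = hclass (a *: z).
Proof.
apply/hclass_eq; rewrite -scalerBr rpredZ //.
by apply/hclass_eq; rewrite hreprK.
Qed.

Lemma hscaleA D n a b (x : homology D n) : hscale a (hscale b x) = hscale (a * b) x.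
Proof. by rewrite -[x]hreprK !hclassZ_subproof scalerA. Qed.

Lemma hscale1 D n : left_id 1 (@hscale D n).
Proof. by move=> x; rewrite -[x]hreprK !hclassZ_subproof scale1r. Qed.

Lemma hscaleDr D n : right_distributive (@hscale D n) +%R.
Proof.
move=> a x y; rewrite -[x]hreprK -[y]hreprK -raddfD !hclassZ_subproof scalerDr.
by rewrite raddfD.
Qed.

Lemma hscaleDl D n (x : homology D n) : {morph (@hscale D n)^~ x : a b / a + b}.
Proof.
by move=> a b; rewrite -[x]hreprK !hclassZ_subproof scalerDl raddfD.
Qed.

HB.instance Definition _ D n :=
  GRing.Zmodule_isLmodule.Build R (homology D n)
    (@hscaleA D n) (@hscale1 D n) (@hscaleDr D n) (@hscaleDl D n).

Lemma hclassZ D n : scalable (@hclass D n).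
Proof. by move=> a z; rewrite -hclassZ_subproof. Qed.

HB.instance Definition _ D n :=
  GRing.isScalable.Build R (cycle D n) (homology D n) _ (@hclass D n) (@hclassZ D n).

Section HypergraphChains.
Variable H : hypergraph V.

Definition simplicial_chains (cH : is_complex H) : subcomplex :=
  Subcomplex (Rspan_closed H)
    (fun n c => @Rspan_sub H setT n c (subsetT _))
    (fun n c => @boundary_complex H n c cH).

(* For [n = 0] the condition [boundary c \in R(H)_{-1} = 0] always holds. *)
Definition Inf_mod (n : nat) : {pred chain} :=
  [pred c : chain | (c \in Rspan H n) &&
                    (if n is m.+1 then boundary c \in Rspan H m else true)].

Definition Sup_mod (n : nat) : {pred chain} :=
  [pred c : chain | `[< exists a b, [/\ a \in Rspan H n, b \in Rspan H n.+1
                                      & c = a + boundary b] >]].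

Lemma Inf_closed n : submod_closed (Inf_mod n).
Proof.
split=> [|a x y /andP[xD bx] /andP[yD yb]]; rewrite inE.
  by rewrite rpred0 linear0; case: n => // n; rewrite rpred0.
rewrite rpredD ?rpredZ //=; case: n bx yb {xD yD} => // n bx yb.
by rewrite linearP rpredD ?rpredZ.
Qed.

Lemma Sup_closed n : submod_closed (Sup_mod n).
Proof.
split=> [|k _ _ /asboolP[a [b [aD bD ->]]] /asboolP[a' [b' [aD' bD' ->]]]]; apply/asboolP.
  by exists 0, 0; rewrite !rpred0 linear0 addr0.
exists (k *: a + a'), (k *: b + b'); rewrite !rpredD ?rpredZ //; split=> //.
by rewrite linearP /= scalerDr addrACA.
Qed.

Lemma Inf_dim n c : c \in Inf_mod n -> c \in Rspan setT n.
Proof. by case/andP => /(Rspan_sub (subsetT _)). Qed.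

Lemma is_complexT : is_complex [set~ (set0 : {set V})].
Proof. by apply/is_complexP; split=> [|s t _ _]; rewrite !inE ?eqxx. Qed.

Lemma Rspan_boundary_dim n c :
  c \in Rspan setT n.+1 -> boundary c \in Rspan [set~ (set0 : {set V})] n.
Proof.
move=> cn; apply: boundary_complex is_complexT _.
apply/RspanP => s /(RspanP _ _ _ cn)[_ sn]; split=> //.
by rewrite !inE -card_gt0 sn.
Qed.

Lemma Sup_dim n c : c \in Sup_mod n -> c \in Rspan setT n.
Proof.
case/asboolP => a [b [aD bD ->]].
rewrite rpredD // ?(Rspan_sub (subsetT _) aD) //.
exact: Rspan_sub (subsetT _) (Rspan_boundary_dim (Rspan_sub (subsetT _) bD)).
Qed.

Lemma Inf_boundary n c : c \in Inf_mod n.+1 -> boundary c \in Inf_mod n.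
Proof.
case/andP => _ bc; rewrite inE bc /=.
by case: n {bc} => // n; rewrite boundaryK rpred0.
Qed.

Lemma Sup_boundary n c : c \in Sup_mod n.+1 -> boundary c \in Sup_mod n.
Proof.
case/asboolP => a [b [aD bD ->]]; apply/asboolP; exists 0, a.
by rewrite rpred0 linearD /= boundaryK addr0 add0r.
Qed.

Definition Inf : subcomplex := Subcomplex Inf_closed Inf_dim Inf_boundary.
Definition Sup : subcomplex := Subcomplex Sup_closed Sup_dim Sup_boundary.

End HypergraphChains.

Definition Delta_chains (H : hypergraph V) : subcomplex :=
  simplicial_chains (Delta_set_complex H : is_complex (Delta H)).

Definition delta_chains (H : hypergraph V) : subcomplex :=
  simplicial_chains (delta_set_complex H : is_complex (delta H)).

End Chains.

Arguments homology {R d V} D n.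
Arguments Inf R {d V} H.
Arguments Sup R {d V} H.
Arguments Delta_chains R {d V} H.
Arguments delta_chains R {d V} H.

Section HomologyMap.
Variables (R : comPzRingType) (d d' : Order.disp_t).
Variables (V : finOrderType d) (V' : finOrderType d').

Definition chain_map (f : chain R V -> chain R V')
    (D : subcomplex R V) (D' : subcomplex R V') : Prop :=
  forall n c, c \in D n -> f c \in D' n /\ f (boundary c) = boundary (f c).

Variables (f : {linear chain R V -> chain R V'}).
Variables (D : subcomplex R V) (D' : subcomplex R V').
Hypothesis fDD' : chain_map f D D'.

Lemma cycle_map_subproof n (z : cycle D n) : f (cycle_val z) \in cycles D' n.
Proof.
have /andP[zD /eqP bz] := cycleP z; have [fz bf] := fDD' zD.
by rewrite inE fz -bf bz linear0 eqxx.
Qed.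

Definition cycle_map n (z : cycle D n) : cycle D' n := Cycle (cycle_map_subproof z).

(* [f_*[z] = [f z]], see [homology_mapE]. *)
Definition homology_map n (x : homology D n) : homology D' n :=
  hclass (cycle_map (hrepr x)).

Lemma homology_mapE n (z : cycle D n) :
  homology_map (hclass z) = hclass (cycle_map z).
Proof.
apply/hclass_eq; have /hclass_eq/asboolP[b bD] := hreprK (hclass z).
set y := hrepr _ => e; apply/asboolP; have [fb bf] := fDD' bD; exists (f b) => //.
by rewrite -bf -e /= linearB.
Qed.

Lemma homology_map_is_linear n : linear (@homology_map n).
Proof.
move=> a x y; rewrite -[x]hreprK -[y]hreprK -linearP !homology_mapE -linearP.
by congr hclass; apply: val_inj; rewrite /= linearP.
Qed.

HB.instance Definition _ n :=
  GRing.isLinear.Build R (homology D n) (homology D' n) _ (@homology_map n)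
    (@homology_map_is_linear n).

Definition homology_hom n : {linear homology D n -> homology D' n} := @homology_map n.

End HomologyMap.

(* Homomorphisms of graded modules from the homology of a subcomplex of chains
   on [V] to that of a subcomplex of chains on [V'], bundled with their source
   and target. *)
Record hom_homology (R : comPzRingType) (d d' : Order.disp_t)
    (V : finOrderType d) (V' : finOrderType d') := HomHomology {
  hom_src : subcomplex R V;
  hom_tgt : subcomplex R V';
  hom_map : forall n, {linear homology hom_src n -> homology hom_tgt n} }.

Section Push.
Variables (R : comPzRingType) (d d' : Order.disp_t).
Variables (V : finOrderType d) (V' : finOrderType d') (phi : V -> V').

(* The sign of the permutation sorting [phi v_0, ..., phi v_n], where
   s = {v_0 < ... < v_n}, is [(-1)] to the number of inversions. *)
Definition inversions (s : {set V}) : nat :=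
  #|[set p : V * V | [&& p.1 \in s, p.2 \in s, (p.1 < p.2)%O
                       & (phi p.2 < phi p.1)%O]]|.

(* [#|phi @: s| == #|s|] says that [phi] is injective on [s]. *)
Definition simplex_push (s : {set V}) : chain R V' :=
  if #|phi @: s| == #|s| then (-1) ^+ inversions s *: simplex R (phi @: s) else 0.

Definition push_fun (c : chain R V) : chain R V' := \sum_s c s *: simplex_push s.

Lemma push_is_linear : linear push_fun.
Proof.
move=> a x y; rewrite /push_fun scaler_sumr -big_split /=.
by apply: eq_bigr => s _; rewrite !ffunE scalerDl scalerA.
Qed.

HB.instance Definition _ :=
  GRing.isLinear.Build R (chain R V) (chain R V') _ push_fun push_is_linear.

Definition push : {linear chain R V -> chain R V'} := push_fun.

End Push.

Arguments push R {d d' V V'} phi.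

Section Iota.
Variables (R : comPzRingType) (d : Order.disp_t) (V : finOrderType d).

Definition incl : {linear chain R V -> chain R V} := idfun.

Lemma incl_chain_map (D D' : subcomplex R V) :
  (forall n c, c \in D n -> c \in D' n) -> chain_map incl D D'.
Proof. by move=> DD' n c /DD'. Qed.

Variable H : hypergraph V.

Lemma delta_sub_Inf : chain_map incl (delta_chains R H) (Inf R H).
Proof.
apply: incl_chain_map => n c cd; rewrite inE; apply/andP.
split; first exact: Rspan_sub (delta_set_sub H) cd.
case: n cd => // n /(boundary_complex (delta_set_complex H)).
exact: Rspan_sub (delta_set_sub H).
Qed.

Lemma Inf_sub_Sup : chain_map incl (Inf R H) (Sup R H).
Proof.
apply: incl_chain_map => n c /andP[cH _]; apply/asboolP; exists c, 0.
by rewrite rpred0 linear0 addr0.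
Qed.

Lemma Inf_Sup_bij n : bijective (homology_hom Inf_sub_Sup n).
Proof.
have inj : injective (homology_hom Inf_sub_Sup n).
  have h0 D : (0 : homology D n) = hclass 0 by rewrite raddf0.
  apply: raddf_inj => x; rewrite -[x]hreprK !h0 /= homology_mapE => /hclass_eq; rewrite subr0 => /asboolP[_ /asboolP[a [b [aH _ ->]]]].
  rewrite linearD /= boundaryK addr0 => ea.
  apply/hclass_eq; rewrite subr0.
  apply/asboolP; exists a => //; rewrite inE aH -ea /=.
  by have /andP[/andP[]] := cycleP (hrepr x).
have surj y : exists x, homology_hom Inf_sub_Sup n x = y.
  rewrite -[y]hreprK; move: (hrepr y) => {y} z.
  have /andP[/asboolP[a [b [aH bH ez]]] /eqP bz] := cycleP z.
  have ba : boundary a = 0 by rewrite -bz ez linearD /= boundaryK addr0.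
  have aZ : a \in cycles (Inf R H) n.
    apply/andP; split; last exact/eqP.
    by apply/andP; split=> //; rewrite ba; case: (n) => // m; rewrite rpred0.
  exists (hclass (Cycle aZ)); rewrite /= homology_mapE; apply/hclass_eq/asboolP.
  exists (- b); last by rewrite /= ez linearN opprD addrA subrr add0r.
  by rewrite rpredN; apply/asboolP; exists b, 0; rewrite rpred0 linear0 addr0.
exists (fun y => projT1 (cid (surj y))) => [x|y]; last exact: projT2 (cid (surj y)).
by apply: inj; exact: projT2 (cid (surj (homology_hom Inf_sub_Sup n x))).
Qed.

Lemma Sup_sub_Delta : chain_map incl (Sup R H) (Delta_chains R H).
Proof.
apply: incl_chain_map => n c /asboolP[a [b [aH bH ->]]].
apply: rpredD; first exact: Rspan_sub (Delta_set_sub H) aH.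
apply: boundary_complex (Delta_set_complex H) _.
exact: Rspan_sub (Delta_set_sub H) bH.
Qed.

Definition iota_delta n : {linear homology (delta_chains R H) n -> homology (Inf R H) n} :=
  homology_hom delta_sub_Inf n.

(* The inclusion of [Inf] into [Sup] induces the isomorphism [Inf_Sup_bij]
   identifying their homologies. *)
Definition iota_Delta n : {linear homology (Inf R H) n -> homology (Delta_chains R H) n} :=
  homology_hom Sup_sub_Delta n \o homology_hom Inf_sub_Sup n.

End Iota.

Arguments iota_delta R {d V} H n.
Arguments iota_Delta R {d V} H n.

(* Main.v *)
Require Import Defs.
From mathcomp Require Import all_boot all_order all_algebra.
From mathcomp Require Import boolp.
Set Implicit Arguments.
Unset Strict Implicit.
Unset Printing Implicit Defensive.
Import Order.TTheory GRing.Theory.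
Local Open Scope ring_scope.

(** Everything reduces to one fact, [push_boundary]: the linear map [push phi]
    commutes with the boundary on the whole ambient chain module. Each of the
    three complexes is cut out of that module by the spans [Rspan H n] and the
    boundary operator. As [push phi] sends [Rspan E n] to [Rspan E' n] whenever
    [phi] sends the members of [E] into [E'], it restricts to all three of them.
    Both squares then commute because the horizontal maps are inclusions: on a
    representative cycle [z], either path gives the class of [push phi z].
    When [H] is a complex, [delta H = H = Delta H] and [Inf H] consists of all
    chains on [H]. The three subcomplexes are then equal, and the three
    homology maps are the one induced by [push phi] between equal complexes.

    To prove [push_boundary], compare the two sides on a simplex [s]. Deleting
    [v] from [s] and then sorting the images gives, for every [v] in [s], a sign
    that depends only on [s], times (-1) to the power
    [#|{u in s, phi u < phi v}| + #|{u in s, u < v, phi u = phi v}|]; this is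
    [odd_vindex_inversions]. If [phi] is injective on [s], the second count
    vanishes and the first is the position of [phi v] in [phi s], so the terms
    are those of the boundary of [push s]. If [phi] identifies [a < b] in [s],
    only the faces opposite [a] and [b] can survive. They have the same image
    [phi s] and the same first count, as [phi a = phi b]. If they do survive, no
    other vertex has that image, so the second count is 0 for [a] and 1 for [b],
    and the two terms cancel. *)

(** * Signs of the faces of an image simplex *)

Section Signs.
Variables (d d' : Order.disp_t).
Variables (V : finOrderType d) (V' : finOrderType d') (phi : V -> V').
Implicit Types (s : {set V}) (v : V).

Definition image_vindex s v : nat := #|[set u in s | (phi u < phi v)%O]|.

Definition tie_vindex s v : nat :=
  #|[set u in s | (u < v)%O && (phi u == phi v)]|.

Definition inversions_below s v : nat :=
  #|[set u in s | (u < v)%O && (phi v < phi u)%O]|.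

Definition inversions_above s v : nat :=
  #|[set u in s | (v < u)%O && (phi u < phi v)%O]|.

Lemma inversionsD1 s v : v \in s ->
  inversions phi s =
    (inversions phi (s :\ v) + (inversions_below s v + inversions_above s v))%N.
Proof.
move=> vs; rewrite /inversions -!sum1dep_card /=.
rewrite (bigID (fun p : V * V => (p.1 != v) && (p.2 != v))) /=; congr (_ + _)%N.
  by apply: eq_bigl => -[x y] /=; rewrite !inE; do ![case: eqP => //= _];
     rewrite ?andbF ?andbT //; case: (x \in s).
(* The pairs that involve [v] are the [(u, v)] and the [(v, u)]. *)
rewrite (bigID (fun p : V * V => p.2 == v)) /=; congr (_ + _)%N.
  rewrite sum1dep_card -[RHS](card_in_imset (f := fun u => (u, v))); last by move=> x y _ _ [].
  apply: eq_card => -[x y]; apply/idP/imsetP => /=.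
    rewrite inE /= => /andP[/andP[/and4P[xs _ xy yx] _] /eqP yv].
    by exists x; rewrite ?inE ?xs -?yv ?xy.
  by case=> u; rewrite inE => /and3P[us uv vu] [-> ->]; rewrite inE /= us vs uv vu eqxx andbF.
rewrite sum1dep_card -[RHS](card_in_imset (f := fun u => (v, u))); last by move=> x y _ _ [].
apply: eq_card => -[x y]; apply/idP/imsetP => /=.
  rewrite inE /= => /andP[/andP[/and4P[_ ys xy yx]]].
  rewrite negb_and !negbK => /orP[/eqP xv _|-> //].
  by exists y; rewrite ?inE ?ys -?xv ?xy.
case=> u; rewrite inE => /and3P[us vu uv] [-> ->].
by rewrite inE /= us vs vu uv eqxx (gt_eqF vu).
Qed.

Lemma card_setID (P Q : pred V) s :
  #|[set u in s | P u]| =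
    (#|[set u in s | P u && Q u]| + #|[set u in s | P u && ~~ Q u]|)%N.
Proof.
rewrite -(cardsID [set u | Q u]); congr (_ + _)%N; apply: eq_card => u;
  by rewrite !inE -?andbA // andbC -andbA.
Qed.

Lemma vindexE s v :
  vindex s v = (#|[set u in s | (u < v)%O && (phi u < phi v)%O]| +
                (inversions_below s v + tie_vindex s v))%N.
Proof.
rewrite /vindex (card_setID _ (fun u => (phi u < phi v)%O)); congr (_ + _)%N.
rewrite (card_setID _ (fun u => (phi v < phi u)%O)); congr (_ + _)%N;
  by apply: eq_card => u; rewrite !inE -!andbA; do 2![congr (_ && _)]; case: ltgtP.
Qed.

Lemma image_vindexE s v :
  image_vindex s v = (#|[set u in s | (u < v)%O && (phi u < phi v)%O]| +
                      inversions_above s v)%N.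
Proof.
rewrite /image_vindex (card_setID _ (fun u => (u < v)%O)); congr (_ + _)%N;
  apply: eq_card => u; rewrite !inE; congr (_ && _); rewrite andbC //.
by case: ltgtP => // ->; rewrite ltxx.
Qed.

(** The inversions of [s] lost by deleting [v] come in two kinds. Those below
    [v] also count in [vindex s v], and those above [v] in [image_vindex s v], so
    both kinds disappear modulo 2. *)
Lemma odd_vindex_inversions s v : v \in s ->
  odd (vindex s v + inversions phi (s :\ v)) =
  odd (inversions phi s + (image_vindex s v + tie_vindex s v)).
Proof.
move=> vs; rewrite (inversionsD1 vs) vindexE image_vindexE !oddD.
by case: (odd (inversions_below _ _)); case: (odd (inversions_above _ _));
   case: (odd (tie_vindex _ _)); case: (odd (inversions _ _)); case: (odd #|_|).
Qed.

Lemma image_vindex_inj s v : {in s &, injective phi} ->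
  image_vindex s v = vindex (phi @: s) (phi v).
Proof.
move=> phi_inj; rewrite /image_vindex /vindex -[LHS](card_in_imset (f := phi)); last first.
  by move=> x y; rewrite !inE => /andP[xs _] /andP[ys _]; apply: phi_inj.
apply: eq_card => w; rewrite [RHS]inE; apply/imsetP/andP.
  by case=> u; rewrite inE => /andP[us uv] ->; rewrite imset_f.
by case=> /imsetP[u us ->] uv; exists u; rewrite ?inE ?us.
Qed.

Lemma tie_vindex_inj s v : {in s &, injective phi} -> v \in s -> tie_vindex s v = 0%N.
Proof.
move=> phi_inj vs; apply: eq_card0 => u; rewrite !inE; apply/negP.
by case/and3P => us uv /eqP /(phi_inj _ _ us vs) e; rewrite e ltxx in uv.
Qed.

Lemma imsetD1_inj s v : {in s &, injective phi} -> v \in s ->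
  phi @: (s :\ v) = (phi @: s) :\ phi v.
Proof.
move=> phi_inj vs; apply/setP => w; rewrite in_setD1; apply/imsetP/andP.
  case=> u; rewrite in_setD1 => /andP[uv us] ->; rewrite imset_f //; split=> //.
  by apply: contraNneq uv => /(phi_inj _ _ us vs)->.
case=> wv /imsetP[u us e]; exists u; rewrite // in_setD1 us andbT.
by apply: contraNneq wv => uv; rewrite e uv.
Qed.

Lemma imsetD1_tie s v w : v \in s -> w \in s -> v != w -> phi v = phi w ->
  phi @: (s :\ v) = phi @: s.
Proof.
move=> vs ws vw e; rewrite -[in RHS](setD1K vs) imsetU1 e.
by apply/esym/setUidPr; rewrite sub1set imset_f // in_setD1 eq_sym vw.
Qed.

End Signs.

(** * The push-forward is a chain map *)

Section Push.
Variables (R : comPzRingType) (d d' : Order.disp_t).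
Variables (V : finOrderType d) (V' : finOrderType d') (phi : V -> V').
Implicit Types (s : {set V}) (c : chain R V).

Lemma push_simplex s : push R phi (simplex R s) = simplex_push R phi s.
Proof.
rewrite /= /push_fun (bigD1 s) //= big1 => [|t ts]; last first.
  by rewrite ffunE (negPf ts) scale0r.
by rewrite ffunE eqxx scale1r addr0.
Qed.

(** The sign on the left mixes the order of [V] with that of [V']; on the right
    only [inversions phi s], which is common to all faces, and counts of vertices
    of [s] remain. Taking the latter in [s] rather than in [phi @: s] lets one
    formula serve whether or not [phi] is injective on [s]. *)
Lemma push_face s v : v \in s ->
  (-1) ^+ vindex s v *: simplex_push R phi (s :\ v) =
  if #|phi @: (s :\ v)| == #|s :\ v|
  then (-1) ^+ (inversions phi s + (image_vindex phi s v + tie_vindex phi s v))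
         *: simplex R (phi @: (s :\ v))
  else 0.
Proof.
move=> vs; rewrite /simplex_push; case: ifP => _; last by rewrite scaler0.
rewrite scalerA -exprD; congr (_ *: _).
by rewrite -signr_odd odd_vindex_inversions // signr_odd.
Qed.

Lemma push_boundary_inj s : {in s &, injective phi} -> (1 < #|s|)%N ->
  \sum_(v in s) (-1) ^+ vindex s v *: simplex_push R phi (s :\ v) =
  boundary (simplex_push R phi s).
Proof.
move=> phi_inj s2; rewrite /simplex_push card_in_imset // eqxx linearZ /=.
rewrite boundary_simplex /simplex_boundary card_in_imset // s2.
rewrite big_imset //= scaler_sumr; apply: eq_bigr => v vs.
rewrite push_face // card_in_imset ?eqxx; last first.
  by move=> x y /setD1P[_ xs] /setD1P[_ ys]; apply: phi_inj.
rewrite image_vindex_inj // tie_vindex_inj // addn0 imsetD1_inj //.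
by rewrite scalerA exprD.
Qed.

Lemma push_boundary_tie s a b : a \in s -> b \in s -> (a < b)%O -> phi a = phi b ->
  \sum_(v in s) (-1) ^+ vindex s v *: simplex_push R phi (s :\ v) = 0.
Proof.
move=> as_ bs ab e; have anb : a != b by rewrite lt_eqF.
have bna : b != a by rewrite eq_sym.
(* A face that contains both [a] and [b] is collapsed by [phi]. *)
rewrite (bigD1 a) //= (bigD1 b) /= ?bs // big1 ?addr0; last first.
  move=> v /andP[/andP[vs va] vb]; rewrite push_face //; case: ifP => // /imset_injP.
  move=> /(_ a b); rewrite !in_setD1 as_ bs !(eq_sym _ v) va vb => /(_ isT isT e) ab_eq.
  by rewrite ab_eq eqxx in anb.
rewrite !push_face // (imsetD1_tie as_ bs anb e) (imsetD1_tie bs as_ bna (esym e)).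
have -> : #|s :\ b| = #|s :\ a|.
  by have := cardsD1 a s; rewrite (cardsD1 b s) as_ bs => -[].
case: ifP => [cardE|_]; last by rewrite addr0.
have phi_inj : {in s :\ a &, injective phi}.
  by apply/imset_injP; rewrite (imsetD1_tie as_ bs anb e).
(* Injectivity on [s :\ a] leaves only [a] and [b] in their common fibre. *)
have fibre u : u \in s -> phi u = phi b -> u != a -> u = b.
  by move=> us uE ua; apply: phi_inj uE; rewrite in_setD1 ?ua ?bna.
have -> : tie_vindex phi s a = 0%N.
  apply: eq_card0 => u; rewrite !inE; apply/negP => /and3P[us ua /eqP uE].
  by have := ltW ab; rewrite -(fibre u) ?leNgt ?ua ?uE // lt_eqF.
have -> : tie_vindex phi s b = 1%N.
  rewrite /tie_vindex -(cards1 a); apply: eq_card => u; rewrite !inE.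
  apply/and3P/eqP => [[us ub /eqP uE]|->]; last by rewrite as_ ab e eqxx.
  by apply/eqP; apply: contraLR ub => ua; rewrite (fibre u) // ltxx.
have -> : image_vindex phi s b = image_vindex phi s a by rewrite /image_vindex e.
by rewrite addn0 addn1 addnS exprS mulN1r scaleNr subrr.
Qed.

Lemma push_simplex_boundary s :
  push R phi (simplex_boundary R s) = boundary (simplex_push R phi s).
Proof.
rewrite [in LHS]/simplex_boundary; case: ifP => s2; last first.
  rewrite linear0 /simplex_push; case: ifP => [/eqP sE|_]; last by rewrite linear0.
  by rewrite linearZ /= boundary_simplex /simplex_boundary sE s2 scaler0.
rewrite linear_sum /=.
under eq_bigr => v _ do rewrite -/(push R phi _) linearZ push_simplex /=.
have [/imset_injP phi_inj|/imset_injP phi_ninj] := boolP (#|phi @: s| == #|s|).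
  exact: push_boundary_inj.
rewrite /simplex_push ifN ?linear0; last exact/imset_injP.
have [a as_ [b bs [ab e]]] :
    exists2 a, a \in s & exists2 b, b \in s & (a < b)%O /\ phi a = phi b.
  apply: contrapT => no_tie; apply: phi_ninj => x y xs ys e.
  case: (ltgtP x y) => // xy; case: no_tie; first by exists x => //; exists y.
  by exists y => //; exists x.
exact: push_boundary_tie e.
Qed.

Lemma push_boundary c : push R phi (boundary c) = boundary (push R phi c).
Proof.
rewrite [boundary c]/boundary [in RHS]/= /push_fun !linear_sum.
by apply: eq_bigr => s _; rewrite !linearZ push_simplex_boundary.
Qed.

Lemma push_Rspan (E : {set {set V}}) (E' : {set {set V'}}) n c :
  (forall s, s \in E -> phi @: s \in E') ->
  c \in Rspan E n -> push R phi c \in Rspan E' n.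
Proof.
move=> EE' /RspanP hc; apply: rpred_sum => s _.
have [->|/hc[sE sn]] := eqVneq (c s) 0; first by rewrite scale0r rpred0.
rewrite rpredZ // /simplex_push; case: ifP => [/eqP cardE|_]; last exact: rpred0.
by rewrite rpredZ // Rspan_simplex ?EE' ?cardE.
Qed.

Lemma push_chain_map_simplicial (K : hypergraph V) (K' : hypergraph V')
    (cK : is_complex K) (cK' : is_complex K') :
  (forall s, s \in K -> phi @: s \in K') ->
  chain_map (push R phi) (simplicial_chains R cK) (simplicial_chains R cK').
Proof.
by move=> KK' n c cn; split; [exact: push_Rspan cn|exact: push_boundary].
Qed.

Lemma push_chain_map_Inf (H : hypergraph V) (H' : hypergraph V') :
  hypergraph_morphism H H' phi -> chain_map (push R phi) (Inf R H) (Inf R H').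
Proof.
move=> phiP n c /andP[cH bc]; split; last exact: push_boundary.
rewrite inE (push_Rspan phiP cH) /=; case: n bc {cH} => // n bc.
by rewrite -push_boundary (push_Rspan phiP bc).
Qed.

End Push.

(** * The three chain complexes of a simplicial complex *)

Section Complexes.
Variables (R : comPzRingType) (d : Order.disp_t) (V : finOrderType d).
Variables (H : hypergraph V) (cH : is_complex H).

(** The remaining fields of a subcomplex are proofs, so its chains determine it. *)
Lemma subcomplex_eq (D D' : subcomplex R V) :
  (forall n c, (c \in D n) = (c \in D' n)) -> D = D'.
Proof.
case: D D' => [m cl dm bd] [m' cl' dm' bd'] /= mm'.
have e : m = m' by apply/funext => n; apply/funext => c; apply: mm'.
by case: _ / e in cl' dm' bd' mm' *; congr Subcomplex; apply: Prop_irrelevance.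
Qed.

Lemma delta_set_id : delta_set H = H.
Proof. by apply/eqP; rewrite eqEsubset delta_set_sub delta_set_max. Qed.

Lemma Delta_set_id : Delta_set H = H.
Proof. by apply/eqP; rewrite eqEsubset Delta_set_sub Delta_set_min. Qed.

Lemma mem_Inf_complex n c : (c \in Inf R H n) = (c \in Rspan H n).
Proof.
apply: andb_idr; case: n => // n; exact: boundary_complex.
Qed.

Lemma delta_chains_complex : delta_chains R H = Inf R H.
Proof.
by apply: subcomplex_eq => n c; rewrite mem_Inf_complex -[in RHS]delta_set_id.
Qed.

Lemma Delta_chains_complex : Delta_chains R H = Inf R H.
Proof.
by apply: subcomplex_eq => n c; rewrite mem_Inf_complex -[in RHS]Delta_set_id.
Qed.

End Complexes.

(** * Induced maps on homology *)

(** The types of the homology maps depend on the subcomplexes, so equal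
    subcomplexes are substituted before the maps can be compared. *)
Lemma eq_HomHomology (R : comPzRingType) (d d' : Order.disp_t)
    (V : finOrderType d) (V' : finOrderType d')
    (f : {linear chain R V -> chain R V'})
    (D1 D2 : subcomplex R V) (D1' D2' : subcomplex R V')
    (h1 : chain_map f D1 D1') (h2 : chain_map f D2 D2') :
  D1 = D2 -> D1' = D2' ->
  HomHomology (homology_hom h1) = HomHomology (homology_hom h2).
Proof.
by move=> e e'; subst D2 D2'; rewrite (Prop_irrelevance h1 h2).
Qed.

Theorem theorem2p11 (d d' : Order.disp_t) (V : finOrderType d) (V' : finOrderType d')
    (R : comPzRingType) (H : hypergraph V) (H' : hypergraph V') (phi : V -> V')
    (phiP : hypergraph_morphism H H' phi) :
  exists (hdelta : chain_map (push R phi) (delta_chains R H) (delta_chains R H'))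
         (hDelta : chain_map (push R phi) (Delta_chains R H) (Delta_chains R H'))
         (hInf : chain_map (push R phi) (Inf R H) (Inf R H')),
  let delta_phi := homology_hom hdelta in
  let Delta_phi := homology_hom hDelta in
  let phi_ := homology_hom hInf in
  [/\ forall n, phi_ n \o iota_delta R H n =1 iota_delta R H' n \o delta_phi n,
      forall n, Delta_phi n \o iota_Delta R H n =1 iota_Delta R H' n \o phi_ n
    & is_complex H -> is_complex H' ->
      [/\ simplicial_map H H' phi,
          HomHomology delta_phi = HomHomology phi_
        & HomHomology Delta_phi = HomHomology phi_]].
Proof.
have [_ _ phi_delta] := morphism_delta phiP.
have [_ _ phi_Delta] := morphism_Delta phiP.
exists (push_chain_map_simplicial _ phi_delta).
exists (push_chain_map_simplicial _ phi_Delta).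
exists (push_chain_map_Inf phiP); split=> [n x|n x|cH cH'].
- by rewrite -[x]hreprK /= !homology_mapE; congr hclass; apply: val_inj.
- by rewrite -[x]hreprK /= !homology_mapE; congr hclass; apply: val_inj.
split; first by split.
  by apply: eq_HomHomology; apply: delta_chains_complex.
by apply: eq_HomHomology; apply: Delta_chains_complex.
Qed.
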